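(* Let $H$ be a uniformly random undirected hypergraph with degree sequence $((d_v)_{v\in V},(\delta_e)_{e\in E})$, where $n=|V|$, and let $DH_n$ be its number of degenerate hyperedges. Then $$\mathbb{E}[DH_n] = |E| - \sum_{e \in E} \frac{\delta_e!\,(n\mathbb{E}[d_U]-\delta_e)!}{(n\mathbb{E}[d_U])!} \sum_{\substack{\mathbf{a} \in \mathbb{N}^{\delta_e}: \\ \sum_{i=1}^{\delta_e} i a_i=\delta_e}} (-1)^{\sum_{i=1}^{\delta_e} (i-1)a_i} \prod_{i=1}^{\delta_e} \left(\frac{1}{a_i!}\left(\frac{n\mathbb{E}[d_U^i]}{i}\right)^{a_i} \right).$$
   Context: $\mathbb{N}$ contains $0$, and $0^0=1$. Let $V$ be a finite vertex set with $n=|V|$ and $E$ a finite set of (labelled) hyperedges. An undirected degree sequence consists of vertex degrees $d_v\in\mathbb{N}$ ($v\in V$) and hyperedge degrees $\delta_e\in\mathbb{N}$ ($e\in E$) with $\sum_{v}d_v=\sum_e\delta_e$. A uniformly random (stub-labeled) undirected hypergraph with this degree sequence is obtained as follows: each vertex $v$ has $d_v$ distinguishable stubs, and all stubs are distributed over the hyperedges so that each hyperedge $e$ receives exactly $\delta_e$ stubs (as a set: the slots within a hyperedge are interchangeable); every such assignment is equally likely. Each hyperedge $e$ is then a multiset of vertices in which $v$ has multiplicity $m_v(e)$ equal to the number of stubs of $v$ assigned to $e$. A hyperedge $e$ is degenerate if $m_v(e)\ge 2$ for some $v\in V$; $DH_n$ is the number of degenerate hyperedges $e\in E$. $U$ is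 a uniformly chosen vertex of $V$, so $n\mathbb{E}[d_U^i]=\sum_{v\in V}d_v^i$. *)

(* Defs.v *)
From HB Require Import structures.
From mathcomp Require Import all_boot all_order all_algebra.

Set Implicit Arguments.
Unset Strict Implicit.
Unset Printing Implicit Defensive.

Import Order.TTheory GRing.Theory Num.Theory.

Local Open Scope ring_scope.

(* Expectation of [X x] for [x] uniformly distributed on the finite set [A]
   (equal to 0 when [A] is empty). *)
Definition uexpect (R : realFieldType) (T : finType) (A : {set T})
    (X : T -> R) : R :=
  (\sum_(x in A) X x) / #|A|%:R.

(* [Tagged _ j : stub d] with [j : 'I_(d v)] is the [j]-th stub of [v]. *)
Definition stub (V : finType) (d : V -> nat) : finType :=
  {v : V & 'I_(d v)}.

(* A stub-labelled hypergraph maps each stub to the hyperedge receiving it, so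
   that the slots inside a hyperedge carry no order. *)
Definition hypergraphs (V E : finType) (d : V -> nat) (delta : E -> nat) :
    {set {ffun stub d -> E}} :=
  [set H : {ffun stub d -> E} | [forall e, #|[set s | H s == e]| == delta e]].

Definition mult (V E : finType) (d : V -> nat) (H : {ffun stub d -> E})
    (v : V) (e : E) : nat :=
  #|[set s : stub d | (tag s == v) && (H s == e)]|.

Definition degenerate (V E : finType) (d : V -> nat) (H : {ffun stub d -> E})
    (e : E) : bool :=
  [exists v, (2 <= mult H v e)%N].

Definition DH (V E : finType) (d : V -> nat) (H : {ffun stub d -> E}) : nat :=
  #|[set e | degenerate H e]|.

(* E[d_U ^ i] for U uniform on V. *)
Definition moment (R : realFieldType) (V : finType) (d : V -> nat) (i : nat) :
    R :=
  uexpect [set: V] (fun v => (d v)%:R ^+ i).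

(* n E[d_U] as a natural number, the form in which factorials are taken. *)
Definition total_degree (V : finType) (d : V -> nat) : nat := \sum_v d v.

Lemma card_moment (R : realFieldType) (V : finType) (d : V -> nat) (i : nat) :
  #|V|%:R * moment R d i = (\sum_v d v ^ i)%N%:R.
Proof.
have -> : moment R d i = (\sum_v d v ^ i)%N%:R / #|V|%:R.
  rewrite /moment /uexpect cardsT natr_sum; congr (_ / _).
  by apply: eq_big => [v|v _]; rewrite ?inE // natrX.
have [V0|V0] := posnP #|V|; last by rewrite mulrC mulfVK // pnatr_eq0 -lt0n.
by rewrite V0 mul0r big1 // => v; have := fintype0 v V0.
Qed.

Lemma card_mean (R : realFieldType) (V : finType) (d : V -> nat) :
  #|V|%:R * moment R d 1 = (total_degree d)%:R.
Proof.
by rewrite card_moment /total_degree; under eq_bigr do rewrite expn1.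
Qed.

(* The vectors (a_1, ..., a_k) of naturals with sum_i i a_i = k; the entry a_i
   is stored at index i - 1, and every a_i is at most k by [weight_bound]. *)
Definition weight_vectors (k : nat) : {set {ffun 'I_k -> 'I_k.+1}} :=
  [set a : {ffun 'I_k -> 'I_k.+1} | \sum_(i < k) i.+1 * a i == k]%N.

Lemma weight_bound (k : nat) (a : 'I_k -> nat) :
  (\sum_(i < k) i.+1 * a i = k)%N -> forall i, (a i < k.+1)%N.
Proof.
move=> ak i; rewrite ltnS -[leqRHS]ak (bigD1 i) //= mulSn -addnA.
exact: leq_addr.
Qed.

(* Main.v *)
Require Import Defs.
From HB Require Import structures.
From mathcomp Require Import all_boot all_order all_fingroup all_algebra.
From mathcomp Require Import ring zify.

(** By linearity, the expected number of non-degenerate hyperedges is the sum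
    over [e] of the probability that [e] is non-degenerate, so each hyperedge
    can be treated alone.

    Permuting the stubs permutes the hypergraphs, so the set of stubs received
    by [e] is uniformly distributed over the [delta e]-subsets of the [N]
    stubs, [N] being the total degree; there are ['C(N, delta e)] of them, which
    accounts for the factorials ([card_hypergraphs_uniform_edge]).  Hence the
    probability in question is [T_k / 'C(N, k)], where [k = delta e] and [T_k]
    counts the [k]-sets of stubs taken from [k] different vertices.

    [T_k] is the [k]-th elementary symmetric function of the degrees [d v], and
    the inner sum of the formula is its expansion in the power sums
    [p_i = \sum_v d v ^ i], that is, the coefficient of [x ^ k] in
    [\prod_v (1 + d v * x) = exp (\sum_i (-1) ^ (i - 1) * p_i * x ^ i / i)].
    Instead of manipulating series, both sides are shown to satisfy Newton's
    recursion [k * T_k = \sum_(1 <= i <= k) (-1) ^ (i - 1) * p_i * T_(k - i)]: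
    for the sets by counting pairs of a set and one of its elements
    ([rainbows_newton]), for the coefficients of the exponential by marking one
    part of a weight vector ([exp_coef_newton]), which is the logarithmic
    derivative in combinatorial form. *)

Set Implicit Arguments.
Unset Strict Implicit.
Unset Printing Implicit Defensive.

Import Order.TTheory GRing.Theory Num.Theory.

Local Open Scope ring_scope.

(** * Rainbow subsets and Newton's recursion *)

(** Colouring a stub by its vertex, a hyperedge is non-degenerate exactly when
    its set of stubs is rainbow, that is, has pairwise distinct colours. *)
Definition rainbow (T V : finType) (f : T -> V) (S : {set T}) : bool :=
  #|f @: S| == #|S|.

Definition rainbows (T V : finType) (f : T -> V) (k : nat) : {set {set T}} :=
  [set S : {set T} | rainbow f S & #|S| == k].

Definition rainbows_avoiding (T V : finType) (f : T -> V) (v : V) (k : nat) :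
    {set {set T}} :=
  [set S in rainbows f k | v \notin f @: S].

(** Adding a point of a colour already present increases the size but not the
    number of colours, and that number never exceeds the size. *)
Lemma rainbowU1 (T V : finType) (f : T -> V) (s : T) (S : {set T}) :
  s \notin S -> rainbow f (s |: S) = (f s \notin f @: S) && rainbow f S.
Proof.
move=> sS; rewrite /rainbow imsetU1 !cardsU1 sS.
by have := leq_imset_card f S; case: (f s \notin _) => /=; lia.
Qed.

(** Removing [s] is a bijection: the rest of a rainbow set contains no other
    point of the colour of [s]. *)
Lemma card_rainbows_containing (T V : finType) (f : T -> V) (s : T) (k : nat) :
  #|[set S in rainbows f k.+1 | s \in S]| = #|rainbows_avoiding f (f s) k|.
Proof.
have avoid (S : {set T}) : f s \notin f @: S -> s \notin S.
  by apply: contraNN; apply: imset_f.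
rewrite -[RHS](card_in_imset (f := fun S => s |: S)); last first.
  move=> S S'; rewrite !inE => /andP[_ /avoid sS] /andP[_ /avoid sS'] eqS.
  by rewrite -(setU1K sS) eqS setU1K.
apply: eq_card => S; rewrite !inE; apply/idP/imsetP => [|[S' S'P ->]].
  case/andP=> /andP[rS /eqP kS] sS; exists (S :\ s); last by rewrite setD1K.
  move: rS kS; rewrite -{1}(setD1K sS) rainbowU1 ?setD11 // (cardsD1 s) sS.
  by move=> /andP[fs rS] /succn_inj kS; rewrite !inE rS kS eqxx fs.
rewrite !inE in S'P; have /andP[/andP[rS /eqP kS] fs] := S'P.
by rewrite setU11 cardsU1 rainbowU1 ?avoid // fs rS kS eqxx.
Qed.

(** A rainbow set either avoids the colour [v] or contains exactly one point of
    that colour.  In generating functions: taking one factor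
    [1 + #|f^-1 v| * x] out of the product. *)
Lemma card_rainbows_split (T V : finType) (f : T -> V) (v : V) (k : nat) :
  (#|rainbows f k.+1| = #|rainbows_avoiding f v k.+1|
     + #|[set s | f s == v]| * #|rainbows_avoiding f v k|)%N.
Proof.
have -> : (#|[set s | f s == v]| * #|rainbows_avoiding f v k| =
    \sum_(s | f s == v) #|[set S in rainbows f k.+1 | s \in S]|)%N.
  rewrite -sum_nat_const; apply: eq_big => [s|s]; rewrite inE // => /eqP <-.
  by rewrite card_rainbows_containing.
(* As sums of indicators, the counts can be compared set by set. *)
have card_sum (P : pred {set T}) :
    #|[set S in rainbows f k.+1 | P S]| = (\sum_(S in rainbows f k.+1) P S)%N.
  rewrite -sum1_card [RHS]big_mkcond [LHS]big_mkcond.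
  by apply: eq_bigr => S _; rewrite in_set; case: (_ \in _); case: (P S).
rewrite (card_sum (fun S => v \notin f @: S)).
under [X in (_ + X)%N]eq_bigr => s do rewrite (card_sum (fun S => s \in S)).
rewrite exchange_big -big_split /= -sum1_card.
apply: eq_bigr => S; rewrite inE => /andP[/imset_injP injS _].
have [/imsetP[s sS ->]|vS] /= := boolP (v \in f @: S).
  rewrite (bigD1 s) //= sS big1 // => t /andP[/eqP fts ts].
  by apply/eqP; rewrite eqb0; apply: contraNN ts => tS; apply/eqP/injS.
rewrite big1 // => s /eqP fs; apply/eqP; rewrite eqb0.
by apply: contraNN vS => sS; rewrite -fs imset_f.
Qed.

(** Iterating [card_rainbows_split] divides the generating function by
    [1 + #|f^-1 v| * x], whence the geometric series. *)
Lemma card_rainbows_avoiding (R : realFieldType) (T V : finType) (f : T -> V)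
    (v : V) (k : nat) :
  #|rainbows_avoiding f v k|%:R =
  \sum_(i < k.+1) (- #|[set s | f s == v]|%:R) ^+ i * #|rainbows f (k - i)|%:R
    :> R.
Proof.
elim: k => [|k IH].
  rewrite big_ord1 expr0 mul1r; congr _%:R; apply: eq_card => S.
  rewrite !inE cards_eq0; case: eqP => [->|_]; last by rewrite andbF.
  by rewrite imset0 in_set0 !andbT.
rewrite big_ord_recl expr0 mul1r subn0 (card_rainbows_split f v).
under eq_bigr do rewrite /= /bump /= add1n exprS subSS -mulrA.
by rewrite -mulr_sumr -IH natrD natrM; ring.
Qed.

(** Count the pairs of a rainbow set of size [k.+1] and an element [s] of it:
    for a given [s] there are as many as rainbow sets of size [k] avoiding the
    colour of [s], which [card_rainbows_avoiding] expands. *)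
Lemma rainbows_newton (R : realFieldType) (T V : finType) (f : T -> V)
    (k : nat) :
  k.+1%:R * #|rainbows f k.+1|%:R =
  \sum_(i < k.+1) (-1) ^+ i * (\sum_v #|[set s | f s == v]|%:R ^+ i.+1) *
    #|rainbows f (k - i)|%:R :> R.
Proof.
have -> : k.+1%:R * #|rainbows f k.+1|%:R =
    \sum_v #|[set s | f s == v]|%:R * #|rainbows_avoiding f v k|%:R :> R.
  transitivity ((\sum_(S in rainbows f k.+1) \sum_(s in S) 1)%N%:R : R).
    rewrite -natrM mulnC -sum_nat_const; congr _%:R.
    by apply: eq_bigr => S; rewrite inE sum1_card => /andP[_ /eqP].
  rewrite (exchange_big_dep xpredT) //=.
  rewrite (partition_big f xpredT) //= natr_sum; apply: eq_bigr => v _.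
  rewrite -natrM -sum_nat_const; congr _%:R.
  apply: eq_big => [s|s /eqP <-]; first by rewrite inE.
  by rewrite -card_rainbows_containing -sum1dep_card.
under eq_bigr do rewrite card_rainbows_avoiding mulr_sumr.
rewrite exchange_big /=; apply: eq_bigr => i _.
rewrite mulr_sumr mulr_suml; apply: eq_bigr => v _.
by rewrite exprNn exprS; ring.
Qed.

(** * The exponential formula *)

Definition weight (K : nat) (a : {ffun 'I_K -> 'I_K.+1}) : nat :=
  (\sum_(i < K) i.+1 * a i)%N.

Definition exp_term (R : realFieldType) (K : nat) (c : nat -> R)
    (a : {ffun 'I_K -> 'I_K.+1}) : R :=
  \prod_(i < K) (((a i)`!%:R)^-1 * c i ^+ a i).

(** The coefficient of [x ^ k] in [exp (\sum_(i < K) c i * x ^ i.+1)] for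
    [k <= K], as [a i <= k] whenever the weight is [k].  The bound [K] is kept
    apart from [k] so that the recursion on [k] stays within one type of
    vectors. *)
Definition exp_coef (R : realFieldType) (K : nat) (c : nat -> R) (k : nat) :
    R :=
  \sum_(a : {ffun 'I_K -> 'I_K.+1} | weight a == k) exp_term c a.

(** Here [b] is [a] with one more part of index [j]; the factor [b j] cancels
    the new factor of the factorial. *)
Lemma exp_term_step (R : realFieldType) (K : nat) (c : nat -> R) (j : 'I_K)
    (a b : {ffun 'I_K -> 'I_K.+1}) :
  (forall i, b i = a i + (i == j) :> nat)%N ->
  (b j)%:R * exp_term c b = c j * exp_term c a.
Proof.
move=> ba; rewrite /exp_term [in LHS](bigD1 j) //= [in RHS](bigD1 j) //=.
rewrite ba eqxx addn1 factS exprS natrM.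
under eq_bigr => i /negbTE ij do rewrite ba ij addn0.
have : (a j).+1%:R != 0 :> R by rewrite pnatr_eq0.
have : (a j)`!%:R != 0 :> R by rewrite pnatr_eq0 -lt0n fact_gt0.
move: _.+1%:R _`!%:R => x y y0 x0.
by field; rewrite x0 y0.
Qed.

Lemma weight_step (K : nat) (j : 'I_K) (a b : {ffun 'I_K -> 'I_K.+1}) :
  (forall i, b i = a i + (i == j) :> nat)%N -> weight b = (weight a + j.+1)%N.
Proof.
move=> ba; rewrite /weight [in LHS](bigD1 j) //= [in RHS](bigD1 j) //=.
rewrite ba eqxx addn1.
under eq_bigr => i /negbTE ij do rewrite ba ij addn0.
by lia.
Qed.

Lemma weight_ge (K : nat) (a : {ffun 'I_K -> 'I_K.+1}) (j : 'I_K) :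
  (j.+1 * a j <= weight a)%N.
Proof. by rewrite /weight (bigD1 j) //= leq_addr. Qed.

(** Marking one of the [a j] parts of index [j] and removing it leaves a vector
    of weight [k - j.+1]. *)
Lemma exp_coef_mark (R : realFieldType) (K : nat) (c : nat -> R) (k : nat)
    (j : 'I_K) :
  (k <= K)%N ->
  \sum_(a : {ffun 'I_K -> 'I_K.+1} | weight a == k) (a j)%:R * exp_term c a =
  if (j < k)%N then c j * exp_coef K c (k - j.+1) else 0.
Proof.
move=> kK; rewrite (bigID (fun a : {ffun 'I_K -> 'I_K.+1} => 0 < a j)%N) /=.
rewrite addrC big1 ?add0r => [|a /andP[_]]; last first.
  by rewrite -eqn0Ngt => /eqP ->; rewrite mul0r.
case: ltnP => [jk|kj]; last first.
  (* A single part of index [j] already has weight [j.+1 > k]. *)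
  by apply: big_pred0 => a; have := weight_ge a j; nia.
pose inc (a : {ffun 'I_K -> 'I_K.+1}) : {ffun 'I_K -> 'I_K.+1} :=
  [ffun i => inord (a i + (i == j))].
pose dec (a : {ffun 'I_K -> 'I_K.+1}) : {ffun 'I_K -> 'I_K.+1} :=
  [ffun i => inord (a i - (i == j))].
have decE a i : dec a i = (a i - (i == j))%N :> nat.
  by rewrite ffunE inordK //; have := ltn_ord (a i); lia.
have incE (a : {ffun 'I_K -> 'I_K.+1}) :
    (a j < K)%N -> forall i, inc a i = (a i + (i == j))%N :> nat.
  move=> aj i; rewrite ffunE inordK //; have := ltn_ord (a i).
  by case: (eqVneq i j) => [->|] /=; lia.
(* Incrementing stays within ['I_K.+1]: entries are below [K] for vectors of
   weight less than [K]. *)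
have small a : weight a == (k - j.+1)%N -> (a j < K)%N.
  by have := weight_ge a j; nia.
rewrite (reindex_onto inc dec) /= => [|a /andP[_ aj]]; last first.
  have dj : (dec a j < K)%N by rewrite decE eqxx; have := ltn_ord (a j); lia.
  apply/ffunP => i; apply/val_inj; rewrite /= incE // decE.
  by case: (eqVneq i j) => [->|] /=; lia.
rewrite /exp_coef mulr_sumr; apply: eq_big => [a|a].
  case: (ltnP (a j) K) => aj.
    have -> : dec (inc a) == a.
      by apply/eqP/ffunP => i; apply/val_inj; rewrite /= decE incE // addnK.
    by rewrite (weight_step (incE a aj)) incE // eqxx; lia.
  (* If [a j = K], then [inord] overflows and decrementing cannot undo it, while
     the weight of [a] is too large: both sides are false. *)
  apply/idP/idP => [/andP[_ /eqP/ffunP/(_ j)/(congr1 val)]|/small].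
    by rewrite /= decE eqxx => H; have := ltn_ord (inc a j); lia.
  by lia.
move=> /andP[/andP[_ incj] /eqP decK].
have aj : (a j < K)%N.
  move/ffunP/(_ j)/(congr1 val): decK.
  by rewrite /= decE eqxx; have := ltn_ord (inc a j); lia.
by rewrite (exp_term_step _ (incE a aj)).
Qed.

(** Write the factor [k.+1] as the weight of [a] and mark a part in each of its
    terms. *)
Lemma exp_coef_newton (R : realFieldType) (K : nat) (c : nat -> R) (k : nat) :
  (k < K)%N ->
  k.+1%:R * exp_coef K c k.+1 =
  \sum_(i < k.+1) i.+1%:R * c i * exp_coef K c (k - i).
Proof.
move=> kK.
have -> : k.+1%:R * exp_coef K c k.+1 = \sum_(j < K) j.+1%:R *
    \sum_(a : {ffun 'I_K -> 'I_K.+1} | weight a == k.+1)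
      (a j)%:R * exp_term c a.
  under [RHS]eq_bigr do rewrite mulr_sumr.
  rewrite exchange_big mulr_sumr /=; apply: eq_bigr => a /eqP <-.
  rewrite /weight natr_sum mulr_suml; apply: eq_bigr => j _.
  by rewrite natrM mulrA.
rewrite [RHS](big_ord_widen K
  (fun i => i.+1%:R * c i * exp_coef K c (k - i))) // [RHS]big_mkcond /=.
apply: eq_bigr => j _; rewrite exp_coef_mark // subSS.
by case: ifP => _; rewrite ?mulr0 ?mulrA.
Qed.

Lemma exp_coef0 (R : realFieldType) (K : nat) (c : nat -> R) :
  exp_coef K c 0 = 1.
Proof.
rewrite /exp_coef (big_pred1 [ffun=> ord0]) => [|a].
  by rewrite /exp_term big1 // => i _; rewrite ffunE /= mulr1 invr1.
apply/eqP/eqP => [a0|->]; last first.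
  by rewrite /weight big1 // => i _; rewrite ffunE muln0.
apply/ffunP => i; apply/val_inj/eqP; rewrite ffunE /=.
by have := weight_ge a i; rewrite a0 leqn0 muln_eq0.
Qed.

(** Both sides satisfy the same recursion and equal [1] at [k = 0]. *)
Lemma card_rainbows (R : realFieldType) (T V : finType) (f : T -> V)
    (K k : nat) :
  (k <= K)%N ->
  #|rainbows f k|%:R =
  exp_coef K (fun i => (-1) ^+ i *
    ((\sum_v #|[set s | f s == v]|%:R ^+ i.+1) / i.+1%:R)) k :> R.
Proof.
elim/ltn_ind: k => -[_ _|k IH kK].
  rewrite exp_coef0 (_ : rainbows f 0 = [set set0]) ?cards1 //.
  apply/setP => S; rewrite !inE cards_eq0 andbC.
  by case: eqP => // ->; rewrite /rainbow imset0 !cards0.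
have k0 : k.+1%:R != 0 :> R by rewrite pnatr_eq0.
apply: (mulfI k0); rewrite rainbows_newton exp_coef_newton //.
apply: eq_bigr => i _; rewrite -IH; [|lia|lia].
congr (_ * _); rewrite mulrCA; congr (_ * _).
by rewrite mulrC divfK // pnatr_eq0.
Qed.

(** * The stubs of a hyperedge form a uniformly random set *)

(** Listing each set before its complement gives two enumerations of [T]; the
    permutation matches equal positions. *)
Lemma perm_of_card (T : finType) (A B : {set T}) :
  #|A| = #|B| -> exists g : {perm T}, g @^-1: B = A.
Proof.
move=> AB; pose l (X : {set T}) := enum X ++ enum (~: X).
have size_l X : size (l X) = #|T| by rewrite size_cat -!cardE cardsC.
have uniq_l X : uniq (l X).
  rewrite cat_uniq !enum_uniq andbT; apply/hasPn => x.
  by rewrite !mem_enum inE.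
have mem_l X x : x \in l X by rewrite mem_cat !mem_enum inE orbN.
have idx x : (index x (l A) < size (l B))%N.
  by rewrite size_l -(size_l A) index_mem.
have inj : injective (fun x => nth x (l B) (index x (l A))).
  move=> x y; rewrite (set_nth_default y) // => /eqP.
  by rewrite nth_uniq // => /eqP /index_inj ->.
exists (perm inj); apply/setP => x; rewrite inE permE nth_cat index_cat.
rewrite -!cardE mem_enum; have [xA|xA] := boolP (x \in A).
  have idxA : (index x (enum A) < #|B|)%N.
    by rewrite -AB cardE index_mem mem_enum.
  by rewrite idxA -mem_enum mem_nth // -cardE.
rewrite AB -[X in (_ < X)%N]addn0 ltn_add2l ltn0 addKn.
apply/negbTE; rewrite -in_setC -mem_enum mem_nth // -cardE.
have /eqP := cardsC A; rewrite AB -(cardsC B) eqn_add2l => /eqP <-.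
by rewrite cardE index_mem mem_enum inE.
Qed.

Lemma card_tag_fiber (I : finType) (n : I -> nat) (i : I) :
  #|[set s : {i : I & 'I_(n i)} | tag s == i]| = n i.
Proof.
pose in_i (x : 'I_(n i)) : {i : I & 'I_(n i)} := Tagged (fun i => 'I_(n i)) x.
have inj_i : injective in_i by move=> x y; apply: eq_from_Tagged.
rewrite -[RHS]card_ord -(card_imset _ inj_i); apply: eq_card => s.
rewrite inE; apply/eqP/imsetP => [|[x _ ->] //].
by case: s => j x /= ji; rewrite /in_i {inj_i in_i}; case: _ / ji; exists x.
Qed.

Lemma card_tagged_ord (I : finType) (n : I -> nat) :
  #|{: {i : I & 'I_(n i)}}| = (\sum_i n i)%N.
Proof.
rewrite card_tagged sumnE big_map big_enum.
by apply: eq_bigr => i _; rewrite card_ord.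
Qed.

(** Stubs and slots [(e, j)] with [j < delta e] are equally numerous, and any
    bijection between them yields a hypergraph. *)
Lemma hypergraphs_nonempty (V E : finType) (d : V -> nat) (delta : E -> nat) :
  (\sum_v d v = \sum_e delta e)%N -> (0 < #|hypergraphs d delta|)%N.
Proof.
move=> sum_eq.
have card_eq : #|stub d| = #|{: {e : E & 'I_(delta e)}}|.
  by rewrite !card_tagged_ord.
pose slot (s : stub d) : {e : E & 'I_(delta e)} :=
  enum_val (cast_ord card_eq (enum_rank s)).
have slot_bij : bijective slot.
  exists (fun t => enum_val (cast_ord (esym card_eq) (enum_rank t))) => x.
    by rewrite /slot enum_valK cast_ordK enum_rankK.
  by rewrite /slot enum_valK cast_ordKV enum_rankK.
apply/card_gt0P; exists [ffun s => tag (slot s)]; rewrite inE.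
apply/forallP => e; rewrite -[X in _ == X]card_tag_fiber.
rewrite -(on_card_preimset (f := slot)); last exact: onW_bij.
by apply/eqP/eq_card => s; rewrite !inE ffunE.
Qed.

(** Precomposition with a permutation of the stubs that maps [A] onto [B] is a
    bijection between the two sets of hypergraphs. *)
Lemma card_hypergraphs_edge (V E : finType) (d : V -> nat) (delta : E -> nat)
    (e : E) (A B : {set stub d}) :
  #|A| = #|B| ->
  #|[set H in hypergraphs d delta | [set s | H s == e] == A]| =
  #|[set H in hypergraphs d delta | [set s | H s == e] == B]|.
Proof.
move=> /perm_of_card [g gBA].
pose precomp (h : {perm stub d}) (H : {ffun stub d -> E}) :
  {ffun stub d -> E} := [ffun s => H (h s)].
have precomp_bij : bijective (precomp g).
  exists (precomp g^-1%g) => H; apply/ffunP => s; rewrite !ffunE.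
    by rewrite permKV.
  by rewrite permK.
rewrite -[LHS](on_card_preimset (f := precomp g)); last exact: onW_bij.
have fiber H e' : [set s | precomp g H s == e'] = g @^-1: [set s | H s == e'].
  by apply/setP => s; rewrite !inE ffunE.
apply: eq_card => H; rewrite !inE fiber -gBA; congr (_ && _).
  by apply: eq_forallb => e'; rewrite fiber card_preimset //; apply: perm_inj.
apply/eqP/eqP => [eq_pre|-> //]; apply/setP => s.
by rewrite -(permKV g s); move/setP/(_ (g^-1%g s)): eq_pre; rewrite !inE.
Qed.

(** The division-free form of the equality between the probability of [P] for
    the set of stubs of [e] and the proportion of [delta e]-sets satisfying
    [P]. *)
Lemma card_hypergraphs_uniform_edge (V E : finType) (d : V -> nat)
    (delta : E -> nat) (e : E) (P : pred {set stub d}) :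
  (#|[set H in hypergraphs d delta | P [set s | H s == e]]| *
     'C(total_degree d, delta e) =
   #|hypergraphs d delta| *
     #|[set S : {set stub d} | P S & #|S| == delta e]|)%N.
Proof.
have split_count (Q : pred {set stub d}) :
    #|[set H in hypergraphs d delta | Q [set s | H s == e]]| =
    (\sum_(S : {set stub d} | Q S && (#|S| == delta e))
      #|[set H in hypergraphs d delta | [set s | H s == e] == S]|)%N.
  rewrite -sum1_card.
  rewrite (partition_big (fun H : {ffun stub d -> E} => [set s | H s == e])
    (fun S : {set stub d} => Q S && (#|S| == delta e))) /=; last first.
    by move=> H; rewrite !inE => /andP[/forallP/(_ e) -> ->].
  apply: eq_bigr => S /andP[QS _]; rewrite -sum1_card; apply: eq_bigl => H.
  by rewrite !inE; case: eqP => [->|]; rewrite ?QS ?andbT ?andbF.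
have card_draws' : #|[set S : {set stub d} | #|S| == delta e]| =
    'C(total_degree d, delta e).
  by rewrite card_draws card_tagged_ord.
have [S0 /eqP S0k|noS] := pickP (fun S : {set stub d} => #|S| == delta e).
  pose c := #|[set H in hypergraphs d delta | [set s | H s == e] == S0]|.
  have const (Q : pred {set stub d}) :
      #|[set H in hypergraphs d delta | Q [set s | H s == e]]| =
      (#|[set S : {set stub d} | Q S & #|S| == delta e]| * c)%N.
    rewrite split_count -sum_nat_const; apply: eq_big => [S|S].
      by rewrite !inE.
    by case/andP=> _ /eqP Sk; apply: card_hypergraphs_edge; rewrite Sk.
  have -> : #|hypergraphs d delta| =
      #|[set H in hypergraphs d delta | predT [set s | H s == e]]|.
    by apply: eq_card => H; rewrite [RHS]in_set andbT.
  rewrite (const P) (const predT) -card_draws' /= mulnAC [RHS]mulnAC.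
  by congr (_ * _)%N; apply: mulnC.
(* With fewer than [delta e] stubs, no hypergraph and no set is counted. *)
rewrite split_count big_pred0 => [|S]; last by rewrite noS andbF.
by rewrite (eq_card0 (A := finset _)) ?muln0 // => S; rewrite inE noS andbF.
Qed.

(** * The expected number of degenerate hyperedges *)

Lemma degenerateE (V E : finType) (d : V -> nat) (H : {ffun stub d -> E})
    (e : E) :
  degenerate H e = ~~ rainbow (@tag V _) [set s : stub d | H s == e].
Proof.
apply/existsP/idP => [[v /card_gt1P [s [t []]]]|].
  rewrite !inE => /andP[/eqP sv se] /andP[/eqP tv te] st.
  apply: contraNN st => /imset_injP inj.
  by apply/eqP/inj; rewrite ?inE // sv tv.
move=> not_inj; apply/existsP.
apply: contraNT not_inj => /existsPn noV; apply/imset_injP => s t.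
rewrite !inE => se te st; apply/eqP; move: (noV (tag s)).
apply: contraNT => neq; apply/card_gt1P; exists s, t.
by rewrite !inE se te st eqxx.
Qed.

Theorem theorem1 (R : realFieldType) (V E : finType)
    (d : V -> nat) (delta : E -> nat)
    (sum_degrees : (\sum_v d v = \sum_e delta e)%N) :
  uexpect (hypergraphs d delta) (fun H => (DH H)%:R : R) =
  #|E|%:R -
  \sum_(e : E)
    ((delta e)`!%:R * (total_degree d - delta e)`!%:R / (total_degree d)`!%:R) *
    \sum_(a in weight_vectors (delta e))
      (-1) ^+ (\sum_(i < delta e) i * a i)%N *
      \prod_(i < delta e)
        (((a i)`!%:R)^-1 * (#|V|%:R * moment R d i.+1 / i.+1%:R) ^+ a i).
Proof.
set hyp := hypergraphs d delta.
have hyp_gt0 : (0 < #|hyp|)%N by apply: hypergraphs_nonempty.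
have hyp0 : #|hyp|%:R != 0 :> R by rewrite pnatr_eq0 -lt0n.
(* Counting the pairs of a hypergraph and a hyperedge, degenerate or not. *)
have sum_DH : (\sum_(H in hyp) DH H + \sum_e
    #|[set H in hyp | rainbow (@tag V _) [set s | H s == e]]| =
    #|hyp| * #|E|)%N.
  have -> : (\sum_e #|[set H in hyp | rainbow (@tag V _) [set s | H s == e]]| =
      \sum_(H in hyp) #|[set e | ~~ degenerate H e]|)%N.
    under eq_bigr do rewrite -sum1dep_card.
    rewrite (exchange_big_dep (mem hyp)) /= => [|e H _ /andP[] //].
    apply: eq_bigr => H Hhyp; rewrite -sum1dep_card; apply: eq_bigl => e.
    by rewrite Hhyp degenerateE negbK.
  rewrite -big_split -sum_nat_const; apply: eq_bigr => H _ /=.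
  rewrite -(cardsC [set e | degenerate H e]); congr (_ + _)%N.
  by apply: eq_card => e; rewrite !inE.
have -> : uexpect hyp (fun H => (DH H)%:R : R) = #|E|%:R - \sum_e
    #|[set H in hyp | rainbow (@tag V _) [set s | H s == e]]|%:R / #|hyp|%:R.
  rewrite /uexpect -natr_sum -mulr_suml -natr_sum.
  apply: (mulIf hyp0); rewrite mulrBl !divfK // -natrM mulnC -sum_DH.
  by rewrite natrD addrK.
congr (_ - _); apply: eq_bigr => e _.
have delta_le : (delta e <= total_degree d)%N.
  by rewrite /total_degree sum_degrees (bigD1 e) //= leq_addr.
have bin0 : 'C(total_degree d, delta e)%:R != 0 :> R.
  by rewrite pnatr_eq0 -lt0n bin_gt0.
have fact0 n : n`!%:R != 0 :> R by rewrite pnatr_eq0 -lt0n fact_gt0.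
have -> : (delta e)`!%:R * (total_degree d - delta e)`!%:R /
    (total_degree d)`!%:R = 'C(total_degree d, delta e)%:R^-1 :> R.
  rewrite -(bin_fact delta_le) !natrM mulrC invfM mulrVK //.
  by rewrite unitfE mulf_neq0.
have -> : \sum_(a in weight_vectors (delta e))
      (-1) ^+ (\sum_(i < delta e) i * a i)%N *
      \prod_(i < delta e)
        (((a i)`!%:R)^-1 * (#|V|%:R * moment R d i.+1 / i.+1%:R) ^+ a i) =
    #|rainbows (@tag V (fun v => 'I_(d v))) (delta e)|%:R :> R.
  rewrite (card_rainbows R _ (leqnn _)); apply: eq_big => [a|a _].
    by rewrite inE.
  rewrite -prodrXr -big_split; apply: eq_bigr => i _ /=.
  (* The sign of a vector is distributed over its parts: [(-1) ^+ i] for each of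
     the [a i] parts of index [i]. *)
  rewrite exprM [in RHS]exprMn mulrCA card_moment natr_sum.
  congr (_ * (_ * _ ^+ _)); congr (_ / _).
  by apply: eq_bigr => v _; rewrite card_tag_fiber natrX.
apply: (mulIf hyp0); rewrite divfK //; apply: (mulIf bin0).
rewrite -natrM card_hypergraphs_uniform_edge natrM.
by rewrite mulrAC [RHS]mulrAC mulrAC; field.
Qed.
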